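(* (1) For each $u\in C(M,\mathbb{R})$, the uniform limit $\lim_{t\to+\infty}\tilde{T}^a_tu$ exists and \[ \lim_{t\to+\infty}\tilde{T}^a_tu=\lim_{t\to+\infty}T^a_tu=\bar{u}. \] (2) For each $t\ge0$ and each $u\in C(M,\mathbb{R})$, $\|\tilde{T}^a_tu-\bar{u}\|_\infty\leq\|T^a_tu-\bar{u}\|_\infty$. (3) $u\in C(M,\mathbb{R})$ is a fixed point of $\{\tilde{T}^a_t\}_{t\ge0}$ (i.e. $\tilde T^a_tu=u$ for all $t\ge0$) if and only if it is a fixed point of $\{T^a_t\}_{t\ge0}$ (i.e. $T^a_tu=u$ for all $t\ge0$).
   Context: $M$ is a compact connected smooth manifold with a fixed $C^\infty$ Riemannian metric. $L_a:TM\to\mathbb{R}$ is a $C^2$ time-independent Lagrangian that is positive definite (the Hessian $\partial^2L_a/\partial v^2(x,v)$ is positive definite for each $(x,v)\in TM$) and superlinear ($L_a(x,v)/\|v\|_x\to+\infty$ as $\|v\|_x\to+\infty$, uniformly in $x\in M$). It is assumed that the Mañé critical value vanishes, $c(L_a)=0$, where $c(L_a)=-\min_\mu\int L_a\,d\mu$ over Borel probability measures on $TM$ invariant under the Euler-Lagrange flow. For $u\in C(M,\mathbb{R})$, $t\ge0$, $x\in M$, the Lax-Oleinik semigroup is \[ T^a_tu(x)=\inf_\gamma\Big\{u(\gamma(0))+\int_0^tL_a(\gamma(s),\dot\gamma(s))\,ds\Big\}, \] the infimum over continuous and piecewise $C^1$ paths $\gamma:[0,t]\to M$ with $\gamma(t)=x$;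 the new Lax-Oleinik semigroup is \[ \tilde T^a_tu(x)=\inf_{t\le\sigma\le2t}\ \inf_\gamma\Big\{u(\gamma(0))+\int_0^\sigma L_a(\gamma(s),\dot\gamma(s))\,ds\Big\}, \] the second infimum over continuous and piecewise $C^1$ paths $\gamma:[0,\sigma]\to M$ with $\gamma(\sigma)=x$. For every $u\in C(M,\mathbb{R})$ the uniform limit $\bar u=\lim_{t\to+\infty}T^a_tu$ exists and is a fixed point of $\{T^a_t\}_{t\ge0}$ (Fathi). $\|\cdot\|_\infty$ is the supremum norm. *)

(* Defs.v *)
(* MathComp-Analysis. *)
From HB Require Import structures.
From mathcomp Require Import all_boot all_order all_algebra.
From mathcomp Require Import all_classical all_reals all_analysis.

Set Implicit Arguments.
Unset Strict Implicit.
Unset Printing Implicit Defensive.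

Import Order.TTheory GRing.Theory Num.Theory.
Import numFieldNormedType.Exports.

Local Open Scope classical_set_scope.
Local Open Scope ring_scope.

(* Functions of class C^k on a set D; only used for open D. *)
Fixpoint Ck_on (R : realType) (V W : normedModType R) (k : nat) (D : set V)
    (f : V -> W) : Prop :=
  if k is k'.+1 then
    (forall x, D x -> differentiable f x) /\
    (forall v : V, Ck_on k' D (fun x => 'D_v f x))
  else forall x, D x -> {for x, continuous f}.

Definition smooth_on (R : realType) (V W : normedModType R) (D : set V)
    (f : V -> W) : Prop :=
  forall k, Ck_on k D f.

(* Charts are total functions, meaningful only on their domain. The field
   [chart_at] says that the domains cover M, and selects a preferred chart at
   each point. *)
Record smooth_atlas (R : realType) (n : nat) (M : ptopologicalType) := SmoothAtlas {
  chart_idx : Type;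
  dom : chart_idx -> set M;
  chart : chart_idx -> M -> 'rV[R]_n;
  chartV : chart_idx -> 'rV[R]_n -> M;
  chart_at : M -> chart_idx;
  dom_chart_at : forall x, dom (chart_at x) x;
  dom_open : forall i, open (dom i);
  codom_open : forall i, open (chart i @` dom i);
  chartK : forall i x, dom i x -> chartV i (chart i x) = x;
  chart_continuous : forall i x, dom i x -> {for x, continuous (chart i)};
  chartV_continuous : forall i y, (chart i @` dom i) y ->
    {for y, continuous (chartV i)};
  transition_smooth : forall i j,
    smooth_on (chart i @` (dom i `&` dom j)) (chart j \o chartV i)
}.

(* A tangent vector is a base point x together with the coordinates of the
   vector in the preferred chart at x. Its coordinates in the other charts
   around x are given by [vcoord]. *)
Record tangent (R : realType) (n : nat) (M : ptopologicalType)
    (A : smooth_atlas R n M) := Tangent { base : M ; vec : 'rV[R]_n }.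

Arguments Tangent {R n M A}.

Section TangentBundle.
Context {R : realType} {n : nat} {M : ptopologicalType}.
Variable A : smooth_atlas R n M.
Local Notation I := (chart_idx A).
Local Notation TM := (tangent A).

HB.instance Definition _ := gen_eqMixin TM.
HB.instance Definition _ := gen_choiceMixin TM.
HB.instance Definition _ := isPointed.Build TM (Tangent point 0).

(* Row-vector convention: the Jacobian acts on the right. *)
Definition vcoord (i : I) (p : TM) : 'rV[R]_n :=
  let c := chart_at A (base p) in
  vec p *m 'J (chart i \o chartV c) (chart c (base p)).

Definition tcoord (i : I) (p : TM) : 'rV[R]_n * 'rV[R]_n :=
  (chart i (base p), vcoord i p).

(* Inverse of [tcoord i], for z.1 in the image of the chart i. *)
Definition tcoordV (i : I) (z : 'rV[R]_n * 'rV[R]_n) : TM :=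
  let x := chartV i z.1 in
  Tangent x (z.2 *m 'J (chart (chart_at A x) \o chartV i) z.1).

(* The manifold topology of TM: W is open iff its image in each chart of TM is
   open. *)
Definition tangent_open (W : set TM) : Prop :=
  forall p i, W p -> dom i (base p) ->
    \forall z \near tcoord i p,
      forall q, dom i (base q) -> tcoord i q = z -> W q.

Let tangent_openT : tangent_open setT.
Proof. by move=> p i _ _; exact: filterE. Qed.

Let tangent_openI : setI_closed tangent_open.
Proof.
move=> U V oU oV p i [Up Vp] pi; have := oU _ _ Up pi; have := oV _ _ Vp pi.
by apply: filterS2 => z HV HU q qi qz; split; [exact: HU|exact: HV].
Qed.

Let tangent_open_bigU (J : Type) (f : J -> set TM) :
  (forall j, tangent_open (f j)) -> tangent_open (\bigcup_j f j).
Proof.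
move=> of_ p i [j _ fjp] pi; have := of_ j _ _ fjp pi.
by apply: filterS => z H q qi qz; exists j => //; exact: H.
Qed.

HB.instance Definition _ := isOpenTopological.Build TM
  tangent_openT tangent_openI tangent_open_bigU.

End TangentBundle.

(* TM with its Borel sigma-algebra. *)
Notation borel_tangent A := (g_sigma_algebraType (@open (tangent A))).

(* gram i x is the Gram matrix at x of the coordinate frame of the chart i. *)
Record riemannian_metric (R : realType) (n : nat) (M : ptopologicalType)
    (A : smooth_atlas R n M) := RiemannianMetric {
  gram : chart_idx A -> M -> 'M[R]_n;
  gram_sym : forall i x, dom i x -> (gram i x)^T = gram i x;
  gram_posdef : forall i x, dom i x -> forall w : 'rV[R]_n, w != 0 ->
    0 < (w *m gram i x *m w^T) 0 0;
  gram_smooth : forall i,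
    smooth_on (chart i @` dom i) (fun y => gram i (chartV i y));
  gram_compat : forall i j (p q : tangent A), base p = base q ->
    dom i (base p) -> dom j (base p) ->
    vcoord i p *m gram i (base p) *m (vcoord i q)^T =
    vcoord j p *m gram j (base p) *m (vcoord j q)^T
}.

Section Lagrangian.
Context {R : realType} {n : nat} {M : ptopologicalType}.
Context {A : smooth_atlas R n M}.
Local Notation TM := (tangent A).

Definition tangent_norm (g : riemannian_metric A) (p : TM) : R :=
  Num.sqrt ((vec p *m gram g (chart_at A (base p)) (base p) *m (vec p)^T) 0 0).

(* The Lagrangian in the coordinates (x, v) of the chart i. *)
Definition local_lagrangian (L : TM -> R) (i : chart_idx A) :
    'rV[R]_n * 'rV[R]_n -> R :=
  L \o tcoordV i.

Definition C2_lagrangian (L : TM -> R) : Prop :=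
  forall i : chart_idx A,
    Ck_on 2 [set z | (chart i @` dom i) z.1] (local_lagrangian L i).

Definition fibre_hessian (L : TM -> R) (i : chart_idx A) (p : TM) : 'M[R]_n :=
  \matrix_(a, b)
    'D_(0, delta_mx 0 a) ('D_(0, delta_mx 0 b) (local_lagrangian L i))
      (tcoord i p).

Definition positive_definite (L : TM -> R) : Prop :=
  forall i p, dom i (base p) -> forall w : 'rV[R]_n, w != 0 ->
    0 < (w *m fibre_hessian L i p *m w^T) 0 0.

Definition superlinear (g : riemannian_metric A) (L : TM -> R) : Prop :=
  forall K : R, exists2 C : R, 0 < C &
    forall p, C < tangent_norm g p -> K < L p / tangent_norm g p.

(* Curves are total functions on R. [velocity] is meaningful at the points
   where the curve is derivable. *)
Definition curve_derivable (gamma : R -> M) (s : R) : Prop :=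
  {for s, continuous gamma} /\
  derivable (chart (chart_at A (gamma s)) \o gamma) s 1.

Definition velocity (gamma : R -> M) (s : R) : TM :=
  Tangent (gamma s) (derive1 (chart (chart_at A (gamma s)) \o gamma) s).

(* gamma is C^1 on the closed interval [a, b]: its velocity exists on ]a, b[
   and extends to a continuous lift of gamma to TM over [a, b]. *)
Definition C1_arc (gamma : R -> M) (a b : R) : Prop :=
  exists V : R -> TM,
    [/\ {within `[a, b], continuous V},
        forall s, s \in `[a, b] -> base (V s) = gamma s
      & forall s, s \in `]a, b[ ->
          curve_derivable gamma s /\ velocity gamma s = V s].

Definition piecewise_C1 (t : R) (gamma : R -> M) : Prop :=
  {within `[0, t], continuous gamma} /\
  exists2 ts : seq R, itv_partition 0 t ts &
    forall k, (k < size ts)%N ->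
      C1_arc gamma (nth 0 (0 :: ts) k) (nth 0 ts k).

Definition action (L : TM -> R) (t : R) (gamma : R -> M) : \bar R :=
  (\int[lebesgue_measure]_(s in `[0%R, t]) (L (velocity gamma s))%:E)%E.

(* d/ds (dL/dv) = dL/dx, tested against every constant direction w. *)
Definition extremal (L : TM -> R) (gamma : R -> M) : Prop :=
  [/\ forall s, curve_derivable gamma s,
      continuous (velocity gamma)
    & forall i s, dom i (gamma s) -> forall w : 'rV[R]_n,
        is_derive s 1
          (fun r => 'D_(0, w) (local_lagrangian L i)
                      (tcoord i (velocity gamma r)))
          ('D_(w, 0) (local_lagrangian L i) (tcoord i (velocity gamma s)))].

(* The value at time t of the extremal with initial velocity p. *)
Definition EL_flow (L : TM -> R) (t : R) (p : TM) : TM :=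
  xget p [set velocity gamma t | gamma in
            [set gamma | extremal L gamma /\ velocity gamma 0 = p]].

Definition flow_invariant (L : TM -> R)
    (mu : probability (borel_tangent A) R) : Prop :=
  forall (t : R) (B : set (borel_tangent A)), measurable B ->
    mu (EL_flow L t @^-1` B) = mu B.

(* c = - min over the invariant measures mu of the integral of L. *)
Definition mane_critical_value (L : TM -> R) (c : R) : Prop :=
  (exists2 mu : probability (borel_tangent A) R, flow_invariant L mu &
     (\int[mu]_p (L p)%:E = (- c)%:E)%E) /\
  (forall mu : probability (borel_tangent A) R, flow_invariant L mu ->
     ((- c)%:E <= \int[mu]_p (L p)%:E)%E).

(* The infima are taken in the extended reals. *)
Definition lax_oleinik (L : TM -> R) (t : R) (u : M -> R) (x : M) : \bar R :=
  ereal_inf [set ((u (gamma 0%R))%:E + action L t gamma)%E | gamma in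
               [set gamma | piecewise_C1 t gamma /\ gamma t = x]].

Definition new_lax_oleinik (L : TM -> R) (t : R) (u : M -> R) (x : M) :
    \bar R :=
  ereal_inf [set lax_oleinik L sigma u x | sigma in `[t, t *+ 2]].

End Lagrangian.

Arguments curve_derivable {R n M} A gamma s.
Arguments velocity {R n M} A gamma s.
Arguments C1_arc {R n M} A gamma a b.
Arguments piecewise_C1 {R n M} A t gamma.

Definition sup_dist (R : realType) (M : Type) (f : M -> \bar R) (u : M -> R) :
    \bar R :=
  ereal_sup [set `|f x - (u x)%:E|%E | x in [set: M]].

Definition uniform_limit (R : realType) (M : Type) (F : R -> M -> \bar R)
    (u : M -> R) : Prop :=
  sup_dist (F t) u @[t --> +oo%R] --> 0%E.

Definition fixed_point (R : realType) (M : Type)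
    (S : R -> (M -> R) -> M -> \bar R) (u : M -> R) : Prop :=
  forall t : R, 0 <= t -> S t u = EFin \o u.

(* Main.v *)
(* The Lagrangian is continuous on TM and the velocity of a C^1 arc extends
   continuously to its closed interval, so the action of a piecewise C^1 curve
   is finite and additive under cutting and gluing. Hence the Lax-Oleinik
   operators form a semigroup, T_(t+s) u = T_s (T_t u), and they are
   nonexpansive for the sup norm. The limit ubar is thus a fixed point of every
   T_s, and |T_s u - ubar| is nonincreasing in s. Since the new operator at
   time t is an infimum of T_s u over s in [t, 2t] containing s = t, it is at
   least as close to ubar as T_t u. A fixed point u of the new semigroup equals
   its own limit ubar. *)
Require Import Defs.
From HB Require Import structures.
From mathcomp Require Import all_boot all_order all_algebra.
From mathcomp Require Import all_classical all_reals all_analysis.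
From mathcomp Require Import measurable_realfun.
Import Order.TTheory GRing.Theory Num.Theory.
Import numFieldNormedType.Exports.
Local Open Scope classical_set_scope.
Local Open Scope ring_scope.

Set Implicit Arguments.
Unset Strict Implicit.
Unset Printing Implicit Defensive.

(** * Tangent coordinates, and continuity of the Lagrangian on [TM] *)

Section Chart.
Context {R : realType} {n : nat} {M : ptopologicalType} {A : smooth_atlas R n M}.
Local Notation TM := (tangent A).

Lemma transition_differentiable (i j : chart_idx A) (x : M) :
  dom i x -> dom j x -> differentiable (chart j \o chartV i) (chart i x).
Proof.
move=> ix jx; have [+ _] := @transition_smooth _ _ _ A i j 1.
by apply; exists x.
Qed.

(* Chain rule for the two transition maps, whose composite is locally the
   identity. *)
Lemma jacobian_transitionK (i j : chart_idx A) (x : M) (v : 'rV[R]_n) :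
  dom i x -> dom j x ->
  v *m 'J (chart j \o chartV i) (chart i x)
    *m 'J (chart i \o chartV j) (chart j x) = v.
Proof.
move=> ix jx.
pose f := chart j \o chartV i; pose h := chart i \o chartV j.
have fx : f (chart i x) = chart j x by rewrite /f /= chartK.
have df : differentiable f (chart i x) by exact: transition_differentiable.
have dh : differentiable h (f (chart i x)).
  by rewrite fx; exact: transition_differentiable.
rewrite -!deriveEjacobian//; last exact: transition_differentiable.
rewrite -fx !deriveE// -[LHS]/(('d h (f (chart i x)) \o 'd f (chart i x)) v).
rewrite -diff_comp// -deriveE; last exact: differentiable_comp.
rewrite -[RHS](@derive_id R _ (chart i x) v); apply: near_eq_derive.
have Vx : {for chart i x, continuous (chartV i)}.
  by apply: chartV_continuous; exists x.
have domj : nbhs (chartV i (chart i x)) (dom j).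
  by rewrite chartK//; apply: open_nbhs_nbhs; split => //; exact: dom_open.
have codi : nbhs (chart i x) (chart i @` dom i).
  by apply: open_nbhs_nbhs; split; [exact: codom_open|exists x].
near=> y.
have [z iz zy] : (chart i @` dom i) y by near: y.
have jz : dom j (chartV i y) by near: y; exact: Vx domj.
by rewrite /h /f /= chartK// -zy chartK.
Unshelve. all: by end_near.
Qed.

(** The vector returns because the Jacobians of the transitions to and from the preferred chart are
    mutually inverse. *)
Lemma tcoordK (i : chart_idx A) (p : TM) : dom i (base p) ->
  tcoordV i (tcoord i p) = p.
Proof.
case: p => x v /= ix; rewrite /tcoordV /tcoord /vcoord /= chartK//.
by rewrite jacobian_transitionK//; exact: dom_chart_at.
Qed.

(** Openness in [TM] is tested in charts, where [tcoordK] turns [L] into [local_lagrangian L i],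
    differentiable and hence continuous. *)
Lemma C2_lagrangian_continuous (L : TM -> R) : C2_lagrangian L -> continuous L.
Proof.
move=> L_C2; apply/continuousP => O oO.
rewrite -[open _]/(tangent_open _) => p i /= Op ip.
have [dL _] := L_C2 i.
have Lc := differentiable_continuous (dL (tcoord i p) (ex_intro2 _ _ (base p) ip erefl)).
have : nbhs (local_lagrangian L i (tcoord i p)) O.
  by apply: open_nbhs_nbhs; split=> //; rewrite /local_lagrangian /= tcoordK.
move=> /Lc; rewrite nbhs_filterE => LO.
apply: (@filterS _ (nbhs (tcoord i p)) _ _ _ _ LO) => z Oz q iq qz.
by move: Oz; rewrite -qz /= /local_lagrangian /= tcoordK.
Qed.
End Chart.

(** * Translating and cutting Lebesgue integrals over intervals *)

Section IntervalIntegral.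
Context {R : realType}.
Local Notation mu := (@lebesgue_measure R).
Implicit Types (c : R) (D : set R).

Lemma measurable_shift c :
  measurable_fun [set: measurableTypeR R]
    (shift c : measurableTypeR R -> measurableTypeR R).
Proof.
by apply: measurable_realfun.continuous_measurable_fun => x;
  apply: cvgD; [exact: cvg_id|exact: cvg_cst].
Qed.

Lemma preimage_shift_itv c (b0 b1 : bool) (x y : R) :
  shift c @^-1` [set` Interval (BSide b0 (x + c)) (BSide b1 (y + c))] =
  [set` Interval (BSide b0 x) (BSide b1 y)].
Proof.
apply/seteqP; split => z /=; rewrite !in_itv /=;
  by case: b0 b1 => -[]; rewrite /= ?(lerD2r, ltrD2r).
Qed.

(** By uniqueness of Lebesgue measure it suffices to compare both sides on half-open intervals,
    whose length is translation invariant. *)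
Lemma lebesgue_measure_shift c D : measurable D ->
  pushforward mu (shift c : measurableTypeR R -> measurableTypeR R) D = mu D.
Proof.
move=> mD; have ms := measurable_shift c.
symmetry; apply: (@lebesgue_measure_unique R
  (pushforward mu (shift c : _ -> measurableTypeR R))) => //.
move=> _ [[x y] _ <-] /=; rewrite /pushforward.
rewrite -[X in `]X, _]%classic](subrK c x) -[X in `]_, X]%classic](subrK c y).
rewrite preimage_shift_itv !lebesgue_measure_itv /= !lte_fin ltrD2r -!EFinB.
by rewrite opprD addrACA subrr addr0.
Qed.

(** For nonnegative functions this is integration against the pushforward, which is Lebesgue measure
    again; then treat positive and negative parts separately. *)
Lemma integral_shift c D (f : R -> \bar R) : measurable D ->
  measurable_fun D f ->
  (\int[mu]_(x in D) f x = \int[mu]_(x in shift c @^-1` D) f (x + c)%R)%E.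
Proof.
move=> mD mf; have ms := measurable_shift c.
have pos (h : R -> \bar R) : measurable_fun D h -> (forall x, 0 <= h x)%E ->
    (\int[mu]_(x in D) h x = \int[mu]_(x in shift c @^-1` D) h (x + c)%R)%E.
  move=> mh h0; rewrite -(ge0_integral_pushforward ms)//.
  apply: eq_measure_integral => B mB _.
  exact/esym/lebesgue_measure_shift.
rewrite integralE [RHS]integralE; congr (_ - _)%E.
- have P := pos _ (measurable_funepos mf) (@funepos_ge0 _ _ f).
  by rewrite P; apply: eq_integral => x _; rewrite !funeposE.
- have P := pos _ (measurable_funeneg mf) (@funeneg_ge0 _ _ f).
  by rewrite P; apply: eq_integral => x _; rewrite !funenegE.
Qed.

Lemma integral_itv_shift c (a b : R) (f : R -> \bar R) :
  measurable_fun `[(a + c)%R, (b + c)%R] f ->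
  (\int[mu]_(x in `[(a + c)%R, (b + c)%R]) f x =
   \int[mu]_(x in `[a, b]) f (x + c)%R)%E.
Proof. by move=> mf; rewrite (integral_shift c)// preimage_shift_itv. Qed.

Lemma itv_cc_setU (a b c : R) : a <= b -> b <= c ->
  `[a, c]%classic = `[a, b] `|` `[b, c].
Proof.
move=> ab bc; apply/seteqP; split=> s /=; rewrite !in_itv /=.
  move=> /andP[h1 h2]; case: (leP s b) => h; [left|right].
    by rewrite h1.
  by rewrite h2 ltW.
move=> [/andP[h1 h2]|/andP[h1 h2]].
  by rewrite h1 (le_trans h2 bc).
by rewrite h2 (le_trans ab h1).
Qed.

Lemma integral_itv_cat (f : R -> \bar R) (a b c : R) : a <= b -> b <= c ->
  measurable_fun `[a, c] f ->
  (\int[mu]_(x in `[a, c]) f x =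
   \int[mu]_(x in `[a, b]) f x + \int[mu]_(x in `[b, c]) f x)%E.
Proof.
move=> ab bc mf.
(* The second piece is opened at [b] to make the union disjoint; a single point does not change the
   integral. *)
have acE : `[a, c]%classic = `[a, b] `|` `]b, c].
  by rewrite -itv_bndbnd_setU ?bnd_simp.
rewrite acE in mf *; rewrite integral_setU//.
  congr (_ + _)%E; rewrite integral_itv_obnd_cbnd//.
  by move: mf => /measurable_funU[].
apply/disj_setPS => x /= []; rewrite !in_itv /= => /andP[_ xb] /andP[bx _].
by move: (lt_le_trans bx xb); rewrite ltxx.
Qed.

End IntervalIntegral.

(** * Translating, cutting and gluing piecewise C^1 curves *)

Section Curves.
Context {R : realType} {n : nat} {M : ptopologicalType} {A : smooth_atlas R n M}.
Implicit Types (gamma : R -> M) (a b c s t : R).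

(** Velocity depends only on the germ of the curve, and both curves use the preferred chart at the
    same point. With [c = 0] this also compares two curves that agree locally. *)
Lemma velocity_shift gamma gamma' c s :
  (\forall r \near s, gamma' r = gamma (r + c)) ->
  velocity A gamma' s = velocity A gamma (s + c) /\
  (curve_derivable A gamma (s + c) -> curve_derivable A gamma' s).
Proof.
move=> E; have Es := nbhs_singleton E.
rewrite /velocity /curve_derivable Es.
set i := chart_at A _.
have nE : \forall r \near s,
    (chart i \o gamma \o shift c) r = (chart i \o gamma') r.
  by apply: filterS E => r /= ->.
have D : (fun h : R => h^-1 *: ((chart i \o gamma \o shift c \o shift s) (h *: 1)
      - (chart i \o gamma \o shift c) s)) =
    (fun h : R => h^-1 *: ((chart i \o gamma \o shift (s + c)) (h *: 1)
      - (chart i \o gamma) (s + c))).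
  by apply/funext => h /=; rewrite addrA.
split.
  congr Tangent; rewrite !derive1E -(near_eq_derive _ nE).
  by rewrite /derive D.
move=> [gc gd]; split.
  have E' : {near s, gamma \o shift c =1 gamma'} by apply: filterS E => r ->.
  have sc : shift c r @[r --> s] --> s + c.
    by apply: cvgD; [exact: cvg_id|exact: cvg_cst].
  rewrite /prop_for /continuous_at Es.
  apply: cvg_trans (near_eq_cvg E') _.
  exact: (cvg_comp _ _ sc gc).
by apply: near_eq_derivable nE _; rewrite /derivable D.
Qed.

Lemma within_continuous_shift {T : topologicalType} (f f' : R -> T) a b c :
  (forall s, s \in `[a, b] -> f' s = f (s + c)) ->
  {within `[(a + c)%R, (b + c)%R], continuous f} ->
  {within `[a, b], continuous f'}.
Proof.
move=> E /subspace_continuousP fc; apply/subspace_continuousP => s /= sab.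
have scab : s + c \in `[(a + c)%R, (b + c)%R].
  by move: sab; rewrite !in_itv /= !lerD2r.
have fcs : f r @[r --> within `[(a + c)%R, (b + c)%R] (nbhs (s + c))] --> f' s.
  by rewrite E//; exact: fc.
(* Translation carries the trace of the neighbourhoods of [s] on [[a, b]] to that of [s + c] on the
   translated interval, so one-sided limits at the ends are covered. *)
have sc : shift c r @[r --> within `[a, b] (nbhs s)] -->
    within `[(a + c)%R, (b + c)%R] (nbhs (s + c)).
  move=> B [e /= e0 eB]; exists e => //= r re rab; apply: eB.
    by move: re; rewrite /= opprD addrACA subrr addr0.
  by move: rab; rewrite /= !in_itv /= !lerD2r.
have E' : {near within `[a, b] (nbhs s), f \o shift c =1 f'}.
  by apply: (@filterS _ (nbhs s) _ setT _ _ filterT) => r _ /= rab; rewrite E.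
exact: cvg_trans (near_eq_cvg E') (cvg_comp _ _ sc fcs).
Qed.

Lemma C1_arc_shift gamma gamma' a b c :
  (forall s, s \in `[a, b] -> gamma' s = gamma (s + c)) ->
  C1_arc A gamma (a + c) (b + c) -> C1_arc A gamma' a b.
Proof.
move=> E [V [Vc VE Vd]]; exists (V \o shift c); split.
- by apply: within_continuous_shift Vc.
- move=> s sab; rewrite /= E// VE//.
  by move: sab; rewrite !in_itv /= !lerD2r.
- move=> s sab.
  have Es : \forall r \near s, gamma' r = gamma (r + c).
    near=> r; apply: E; apply: subset_itv_oo_cc; near: r.
    exact: near_in_itvoo.
  have [vE dE] := velocity_shift Es.
  have /Vd[dV vV] : s + c \in `](a + c)%R, (b + c)%R[.
    by move: sab; rewrite !in_itv /= !ltrD2r.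
  by split; [exact: dE|rewrite vE vV].
Unshelve. all: by end_near.
Qed.

Lemma C1_arc_sub gamma a b a' b' : a <= a' -> b' <= b ->
  C1_arc A gamma a b -> C1_arc A gamma a' b'.
Proof.
move=> aa' b'b [V [Vc VE Vd]]; exists V; split.
- by apply: continuous_subspaceW Vc; apply: subset_itvScc; rewrite bnd_simp.
- move=> s sab; apply: VE; move: sab; rewrite !in_itv /= => /andP[h1 h2].
  by rewrite (le_trans aa' h1) (le_trans h2 b'b).
- move=> s sab; apply: Vd; move: sab; rewrite !in_itv /= => /andP[h1 h2].
  by rewrite (le_lt_trans aa' h1) (lt_le_trans h2 b'b).
Qed.

(* The junction times of [piecewise_C1], as an inductive predicate that also
   allows an arbitrary starting time. *)
Inductive C1_chain (gamma : R -> M) : R -> R -> Prop :=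
| C1_chain_nil a : C1_chain gamma a a
| C1_chain_cons a b c : a < b -> C1_arc A gamma a b -> C1_chain gamma b c ->
    C1_chain gamma a c.

Lemma C1_chainP gamma a b :
  (exists2 ts : seq R, itv_partition a b ts &
    forall k, (k < size ts)%N ->
      C1_arc A gamma (nth 0 (a :: ts) k) (nth 0 ts k)) <->
  C1_chain gamma a b.
Proof.
split=> [[ts]|].
  elim: ts a => [|d ts IH] a ab H.
    by rewrite (itv_partition_nil ab); exact: C1_chain_nil.
  have [/= /andP[ad _] _] := ab.
  apply: (C1_chain_cons ad); first exact: (H 0%N).
  by apply: IH; [exact: itv_partition_cons ab|move=> k kts; exact: (H k.+1)].
elim=> [{}a|{}a d {}b ad Had _ [ts [pts /eqP lts] Hts]].
  by exists [::].
exists (d :: ts); first by split; rewrite /= ?ad// lts.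
by case=> [|k] //= kts; exact: Hts.
Qed.

Lemma C1_chain_le gamma a b : C1_chain gamma a b -> a <= b.
Proof. by elim=> // {}a d {}b /ltW ad _ _; exact: le_trans. Qed.

Lemma C1_chain_cat gamma a b c :
  C1_chain gamma a b -> C1_chain gamma b c -> C1_chain gamma a c.
Proof.
by elim=> // {}a d {}b ad arc _ IH bc; apply: C1_chain_cons ad arc (IH bc).
Qed.

(** Induction on the chain: either [b] falls in the first arc, which is then cut, or the cut is made
    in the remaining chain. *)
Lemma C1_chain_split gamma a b c : a <= b -> b <= c ->
  C1_chain gamma a c -> C1_chain gamma a b /\ C1_chain gamma b c.
Proof.
move=> + + ac; elim: ac b => [{}a b ab ba|{}a d {}c ad arc dc IH b ab bc].
  have -> : b = a by apply/eqP; rewrite eq_le ab ba.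
  by split; exact: C1_chain_nil.
have [bd|db] := ltP b d.
  split.
    (* Arcs of a chain have positive length, so a cut at [a] itself leaves an empty chain. *)
    move: ab; rewrite le_eqVlt => /predU1P[<-|ab]; first exact: C1_chain_nil.
    apply: (C1_chain_cons ab); last exact: C1_chain_nil.
    exact: C1_arc_sub (ltW bd) arc.
  apply: (C1_chain_cons bd); last exact: dc.
  exact: C1_arc_sub ab _ arc.
have [db1 bc1] := IH _ db bc.
by split=> //; apply: C1_chain_cons ad arc db1.
Qed.

Lemma C1_chain_shift gamma gamma' a b c :
  (forall s, s \in `[a, b] -> gamma' s = gamma (s + c)) ->
  C1_chain gamma (a + c) (b + c) -> C1_chain gamma' a b.
Proof.
(* The end points become [a - c] and [b - c], so that the induction runs on the chain of [gamma]
   with free end points. *)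
move=> + ch; rewrite -(addrK c a) -{2}(addrK c b).
rewrite -{1}(addrK c b); move: ch; move: (a + c) (b + c) => {a b} a b.
elim=> [{}a|{}a d {}b ad arc db IH] E; first exact: C1_chain_nil.
have aLd : a - c < d - c by rewrite ltrD2r.
have dLb : d - c <= b - c by rewrite lerD2r (C1_chain_le db).
apply: (C1_chain_cons aLd).
  apply: (@C1_arc_shift gamma gamma' _ _ c); last by rewrite !subrK.
  move=> s; rewrite in_itv /= => /andP[h1 h2].
  by apply: E; rewrite in_itv /= h1 (le_trans h2 dLb).
apply: IH => s; rewrite in_itv /= => /andP[h1 h2].
by apply: E; rewrite in_itv /= h2 (le_trans (ltW aLd) h1).
Qed.

Lemma piecewise_C1_congr gamma gamma' t :
  (forall s, s \in `[0, t] -> gamma' s = gamma s) ->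
  piecewise_C1 A t gamma -> piecewise_C1 A t gamma'.
Proof.
move=> E [gc /C1_chainP ch].
have E0 s : s \in `[0, t] -> gamma' s = gamma (s + 0) by rewrite addr0; exact: E.
split; first by apply: (within_continuous_shift E0); rewrite !addr0.
by apply/C1_chainP/(C1_chain_shift E0); rewrite !addr0.
Qed.

Lemma piecewise_C1_split gamma t s : 0 <= t -> 0 <= s ->
  piecewise_C1 A (t + s) gamma ->
  piecewise_C1 A t gamma /\ piecewise_C1 A s (gamma \o shift t).
Proof.
move=> t0 s0 [gc /C1_chainP/(C1_chain_split t0)[|ch1 ch2]].
  by rewrite lerDl.
split; split.
- apply: continuous_subspaceW gc; apply: subset_itvScc; rewrite bnd_simp//.
  by rewrite lerDl.
- exact/C1_chainP.
- apply: (@within_continuous_shift _ gamma _ _ _ t) => //; rewrite add0r addrC.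
  apply: continuous_subspaceW gc; apply: subset_itvScc; rewrite bnd_simp//.
- apply/C1_chainP; apply: (@C1_chain_shift gamma _ _ _ t) => //.
  by rewrite add0r addrC.
Qed.

Lemma piecewise_C1_glue gamma t s : 0 <= t -> 0 <= s ->
  piecewise_C1 A t gamma -> piecewise_C1 A s (gamma \o shift t) ->
  piecewise_C1 A (t + s) gamma.
Proof.
move=> t0 s0 [gc1 /C1_chainP ch1] [gc2 /C1_chainP ch2].
(* Regularity of the second piece is carried back to [[t, t + s]] by the opposite translation. *)
have E r : r \in `[t, (t + s)%R] -> gamma r = (gamma \o shift t) (r + - t).
  by rewrite /= subrK.
have tts : t <= t + s by rewrite lerDl.
split.
  rewrite (itv_cc_setU t0 tts).
  apply: withinU_continuous => //; [exact: itv_closed|exact: itv_closed|].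
  apply: (within_continuous_shift E).
  by rewrite subrr addrAC subrr add0r.
apply/C1_chainP; apply: C1_chain_cat ch1 _.
apply: (C1_chain_shift E).
by rewrite subrr addrAC subrr add0r.
Qed.
End Curves.

(** * Finiteness and additivity of the action *)

Section Action.
Context {R : realType} {n : nat} {M : ptopologicalType} {A : smooth_atlas R n M}.
Context (L : tangent A -> R) (L_continuous : continuous L).
Implicit Types (gamma : R -> M) (a b c s t : R).
Local Notation mu := (@lebesgue_measure R).
Local Notation speed gamma := (fun s => (L (velocity A gamma s))%:E).

(** Inside the interval the integrand equals [L \o V], continuous on a compact segment; the end
    points, where [velocity] need not match [V], are negligible. *)
Lemma C1_arc_integrable gamma a b : C1_arc A gamma a b ->
  measurable_fun `[a, b] (speed gamma) /\
  (\int[mu]_(s in `[a, b]) speed gamma s \is a fin_num)%E.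
Proof.
move=> [V [Vc _ Vd]].
have Gc : {within `[a, b], continuous (L \o V)}.
  by apply: within_continuous_comp Vc => x _; exact: L_continuous.
have Gi : mu.-integrable `[a, b] (EFin \o (L \o V)).
  by apply: continuous_compact_integrable => //; exact: segment_compact.
have mG : measurable_fun `]a, b[ (EFin \o (L \o V)).
  apply: measurable_funS (measurable_int mu Gi) => //.
  exact: subset_itv_oo_cc.
have GE : {in `]a, b[, EFin \o (L \o V) =1 speed gamma}.
  by move=> s sab; have [_ /= ->] := Vd _ sab.
have ms : measurable_fun `]a, b[ (speed gamma).
  by apply: eq_measurable_fun mG => s; rewrite inE; exact: GE.
split; first exact: emeasurable_fun_itv_cc ms.
rewrite (integral_itv_bndoo _ _ ms).
rewrite (_ : integral _ _ _ = \int[mu]_(s in `[a, b]) (L (V s))%:E)%E.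
  by apply: integrable_fin_num.
rewrite (integral_itv_bndoo _ _ mG).
by apply: eq_integral => s; rewrite inE => /GE.
Qed.

Lemma C1_chain_integrable gamma a b : C1_chain (A := A) gamma a b ->
  measurable_fun `[a, b] (speed gamma) /\
  (\int[mu]_(s in `[a, b]) speed gamma s \is a fin_num)%E.
Proof.
elim=> [{}a|{}a d {}b ad arc db [md fd]].
  by rewrite set_itv1; split; [exact: measurable_fun_set1|rewrite integral_set1].
have [ma fa] := C1_arc_integrable arc.
have dLb := C1_chain_le db.
have m : measurable_fun `[a, b] (speed gamma).
  rewrite (itv_cc_setU (ltW ad) dLb).
  by apply/measurable_funU.
by split=> //; rewrite (integral_itv_cat (ltW ad) dLb m) fin_numD fa fd.
Qed.

Lemma action_measurable gamma t : piecewise_C1 A t gamma ->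
  measurable_fun `[0, t] (speed gamma).
Proof. by move=> [_ /C1_chainP/C1_chain_integrable[]]. Qed.

Lemma action_fin_num gamma t : piecewise_C1 A t gamma ->
  action L t gamma \is a fin_num.
Proof. by move=> [_ /C1_chainP/C1_chain_integrable[]]. Qed.

Lemma velocity_comp_shift gamma c s :
  velocity A (gamma \o shift c) s = velocity A gamma (s + c).
Proof.
have E : \forall r \near s, (gamma \o shift c) r = gamma (r + c)
  by near=> r.
by rewrite (velocity_shift E).1.
Unshelve. all: by end_near.
Qed.

Lemma action_split gamma t s : 0 <= t -> 0 <= s ->
  piecewise_C1 A (t + s) gamma ->
  action L (t + s) gamma = (action L t gamma + action L s (gamma \o shift t))%E.
Proof.
move=> t0 s0 /action_measurable m.
have tts : t <= t + s by rewrite lerDl.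
have m' : measurable_fun `[(0 + t)%R, (s + t)%R] (speed gamma).
  apply: measurable_funS m => //.
  by apply: subset_itvScc; rewrite bnd_simp ?add0r// addrC.
have -> : action L s (gamma \o shift t) =
    (\int[mu]_(r in `[t, (t + s)%R]) speed gamma r)%E.
  rewrite /action -{2}(add0r t) (addrC t s) (integral_itv_shift m').
  by apply: eq_integral => r _; rewrite velocity_comp_shift.
exact: integral_itv_cat t0 tts m.
Qed.

Lemma action_itvoo gamma t : piecewise_C1 A t gamma ->
  action L t gamma = (\int[mu]_(s in `]0%R, t[) speed gamma s)%E.
Proof.
move=> /action_measurable m; apply: integral_itv_bndoo.
by apply: measurable_funS m => //; exact: subset_itv_oo_cc.
Qed.

(** The velocities need agree only on the open interval, since at [0] and [t] they also see the
    curves outside [[0, t]]. Hence the passage through [action_itvoo]. *)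
Lemma action_congr gamma gamma' t :
  piecewise_C1 A t gamma -> piecewise_C1 A t gamma' ->
  (forall s, s \in `[0, t] -> gamma' s = gamma s) ->
  action L t gamma = action L t gamma'.
Proof.
move=> /action_itvoo -> /action_itvoo -> E.
apply: eq_integral => s; rewrite inE /= => st; congr (L _)%:E.
have Es : \forall r \near s, gamma' r = gamma (r + 0).
  near=> r; rewrite addr0; apply: E; apply: subset_itv_oo_cc; near: r.
  exact: near_in_itvoo.
by rewrite (velocity_shift Es).1 addr0.
Unshelve. all: by end_near.
Qed.
End Action.

(** * Sup distance and uniform limits with extended real values *)

Section UniformDistance.
Context {R : realType} {M : ptopologicalType}.
Implicit Types (f : M -> \bar R) (u : M -> R) (F : R -> M -> \bar R).

Lemma sup_dist_leP f u (d : R) :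
  (sup_dist f u <= d%:E)%E <->
  forall x, ((u x - d)%:E <= f x)%E /\ (f x <= (u x + d)%:E)%E.
Proof.
have E x : (`|f x - (u x)%:E| <= d%:E)%E <->
    ((u x - d)%:E <= f x)%E /\ (f x <= (u x + d)%:E)%E.
  (* With a real bound [d], both sides fail at infinite values of [f]. *)
  case: (f x) => [r| |] /=; last 2 first.
  - by rewrite !leye_eq; split=> [|[]].
  - by rewrite leye_eq leeNy_eq; split=> [|[]].
  by rewrite !lee_fin ler_distl; split=> [/andP[]|[-> ->]].
split=> [/ereal_supP H x|H].
  by apply/E; apply: H; exists x.
by apply/ereal_supP => _ [x _ <-]; apply/E.
Qed.

(** The operators take real functions to extended real ones; this allows a value to be fed back into
    an operator through [fine]. *)
Lemma sup_dist_fin_num f u (e : R) :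
  (sup_dist f u <= e%:E)%E -> f = EFin \o (fine \o f).
Proof.
move=> /sup_dist_leP fu; apply/funext => x /=; rewrite fineK//.
have [h1 h2] := fu x; rewrite fin_numE; apply/andP; split.
  by apply/negP => /eqP fx; move: h1; rewrite fx.
by apply/negP => /eqP fx; move: h2; rewrite fx.
Qed.

Lemma sup_dist_ge0 f u : (0 <= sup_dist f u)%E.
Proof.
by apply: le_ereal_sup_tmp; exists `|f point - (u point)%:E|%E => //; exists point.
Qed.

Lemma sup_dist_eqP u v : (forall e : R, 0 < e -> (sup_dist (EFin \o u) v <= e%:E)%E) ->
  u = v.
Proof.
move=> H; apply/funext => x; apply/eqP; rewrite eq_le.
apply/andP; split; apply/ler_addgt0Pr => e /H/sup_dist_leP/(_ x) [];
  by rewrite /= !lee_fin lerBlDr.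
Qed.

Lemma uniform_limitP F u : uniform_limit F u <->
  forall e : R, 0 < e -> \forall t \near +oo, (sup_dist (F t) u <= e%:E)%E.
Proof.
split=> [Fu e e0|H].
  have /Fu : nbhs 0%E [set y : \bar R | (y < e%:E)%E].
    exact: (@nbhs_open_ereal_lt R 0 (fun=> e)).
  by move=> Fe; near=> t; apply/ltW; near: t; exact: Fe.
apply/(@fine_cvgP _ _ _ _ _ 0); split.
  (* Convergence in the extended reals splits into eventual finiteness, for which the bound 1 is
     enough, and convergence of the real parts. *)
  near=> t; have t1 : (sup_dist (F t) u <= 1%:E)%E by near: t; exact: H.
  rewrite ge0_fin_numE ?sup_dist_ge0//.
  by rewrite (le_lt_trans t1) ?ltry.
apply/cvgrPdist_le => e e0; near=> t.
have te : (sup_dist (F t) u <= e%:E)%E by near: t; exact: H.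
rewrite /=.
rewrite sub0r normrN ger0_norm ?fine_ge0 ?sup_dist_ge0//.
by rewrite -lee_fin fineK// ge0_fin_numE ?sup_dist_ge0// (le_lt_trans te) ?ltry.
Unshelve. all: by end_near.
Qed.

Lemma uniform_limit_ex F u (e : R) : 0 < e -> uniform_limit F u ->
  exists2 t0, 0 < t0 & forall t, t0 <= t -> (sup_dist (F t) u <= e%:E)%E.
Proof.
move=> e0 /uniform_limitP/(_ e e0)[t0 [_ H]].
(* The filter gives the bound only for [t0 < t]; adding 1 allows equality, and the maximum ensures
   positivity. *)
exists (Num.max 1 (t0 + 1)); first by rewrite lt_max ltr01.
move=> t; rewrite ge_max => /andP[_ tt]; apply: H.
by rewrite (lt_le_trans _ tt)// ltrDl.
Qed.
End UniformDistance.

(** * Nonexpansiveness, the semigroup law and distance to a fixed point *)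

Section LaxOleinik.
Context {R : realType} {n : nat} {M : ptopologicalType} {A : smooth_atlas R n M}.
Context (L : tangent A -> R) (L_continuous : continuous L).
Implicit Types (u v w : M -> R) (s t e : R) (x : M).

Lemma lax_oleinik_le t u v e x : (forall y, u y <= v y + e) ->
  (lax_oleinik L t u x <= lax_oleinik L t v x + e%:E)%E.
Proof.
move=> uv; rewrite -leeBlDr//; apply/ereal_infP => _ [gamma gx <-].
rewrite leeBlDr// addeAC; apply: ge_ereal_inf.
exists ((u (gamma 0%R))%:E + action L t gamma)%E; first by exists gamma.
by rewrite leeD2r// -EFinD lee_fin.
Qed.

(** Nonexpansiveness. Since [sup_dist] compares with a real function, the value of the operator at
    [w] is given as a real [v]. *)
Lemma lax_oleinik_dist t u v w e : lax_oleinik L t w = EFin \o v ->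
  (sup_dist (EFin \o w) u <= e%:E)%E ->
  (sup_dist (lax_oleinik L t u) v <= e%:E)%E.
Proof.
move=> Tw /sup_dist_leP wu; apply/sup_dist_leP => x.
have [h1 h2] : (forall y, u y <= w y + e) /\ (forall y, w y <= u y + e).
  by split=> y; have := wu y; rewrite /= !lee_fin => -[]; rewrite lerBlDr.
split.
  have := lax_oleinik_le t x h2; rewrite Tw /= => h.
  by rewrite EFinB leeBlDr.
by have := lax_oleinik_le t x h1; rewrite Tw.
Qed.

Lemma lax_oleinik_semigroup s t u w : 0 <= s -> 0 <= t ->
  lax_oleinik L t u = EFin \o w ->
  lax_oleinik L (t + s) u = lax_oleinik L s w.
Proof.
move=> s0 t0 Tu; apply/funext => x; apply/le_anti/andP; split.
  apply/ereal_infP => _ [gamma2 [p2 g2x] <-].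
  have a2 := action_fin_num L_continuous p2.
  (* Moving the finite action of [gamma2] to the left isolates [w (gamma2 0)], itself an infimum
     over curves [gamma1] ending there. *)
  rewrite -leeBlDr// -[(w _)%:E]/((EFin \o w) _) -Tu.
  apply/ereal_infP => _ [gamma1 [p1 g1x] <-].
  pose gamma r := if r <= t then gamma1 r else gamma2 (r - t).
  have E1 r : r \in `[0, t] -> gamma r = gamma1 r.
    by rewrite in_itv /= /gamma => /andP[_ ->].
  have E2 r : r \in `[0, s] -> (gamma \o shift t) r = gamma2 r.
    rewrite in_itv /= /gamma addrK => /andP[r0 _].
    case: ifPn => //; rewrite gerDr => r0'.
    (* At the junction [gamma] takes the value of [gamma1], which [g1x] identifies with
       [gamma2 0]. *)
    have -> : r = 0 by apply/eqP; rewrite eq_le r0 r0'.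
    by rewrite add0r g1x.
  have q1 := piecewise_C1_congr E1 p1.
  have q2 := piecewise_C1_congr E2 p2.
  have q := piecewise_C1_glue t0 s0 q1 q2.
  rewrite leeBlDr// -addeA; apply: ge_ereal_inf.
  exists ((u (gamma 0%R))%:E + action L (t + s) gamma)%E.
    exists gamma => //; split=> //.
    have := E2 s; rewrite in_itv /= s0 lexx addrC => -> //.
  have -> : gamma 0 = gamma1 0 by apply: E1; rewrite in_itv /= lexx.
  rewrite (action_congr L_continuous p1 q1 E1) (action_congr L_continuous p2 q2 E2).
  by have -> := action_split L_continuous t0 s0 q.
(* Conversely, a curve is cut at time [t], and its first part competes in the infimum defining [w]
   at the cutting point. *)
apply/ereal_infP => _ [gamma [p gx] <-].
have [p1 p2] := piecewise_C1_split t0 s0 p.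
have -> := action_split L_continuous t0 s0 p.
rewrite addeA; apply: ge_ereal_inf.
exists ((w ((gamma \o shift t) 0%R))%:E + action L s (gamma \o shift t))%E.
  by exists (gamma \o shift t) => //; split=> //=; rewrite addrC.
apply: leeD2r; rewrite -[(w _)%:E]/((EFin \o w) _) -Tu /= add0r.
apply: ge_ereal_inf.
by exists ((u (gamma 0%R))%:E + action L t gamma)%E => //; exists gamma.
Qed.

(** For large [t0], [T_(t0+s) u = T_s (T_t0 u)] is within [e] of [v], and by nonexpansiveness within
    [e] of [T_s v]. So [T_s v] is within [2e] of [v]. *)
Lemma uniform_limit_fixed_point u v :
  uniform_limit (fun t => lax_oleinik L t u) v -> fixed_point (lax_oleinik L) v.
Proof.
move=> uv s s0.
have H e : 0 < e -> (sup_dist (lax_oleinik L s v) v <= (e + e)%:E)%E.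
  move=> e0; have [t0 t0_gt0 ut] := uniform_limit_ex e0 uv.
  have ut0 := ut t0 (lexx _).
  have /ut uts : t0 <= t0 + s by rewrite lerDl.
  have Tu := sup_dist_fin_num ut0; have Tus := sup_dist_fin_num uts.
  rewrite (lax_oleinik_semigroup s0 (ltW t0_gt0) Tu) in Tus uts.
  have /sup_dist_leP h1 : (sup_dist (lax_oleinik L s v)
      (fine \o lax_oleinik L s (fine \o lax_oleinik L t0 u)) <= e%:E)%E.
    by apply: lax_oleinik_dist Tus _; rewrite -Tu.
  move/sup_dist_leP : uts => h2; apply/sup_dist_leP => x.
  have [h11 h12] := h1 x; have := h2 x; rewrite Tus /= !lee_fin => -[h21 h22].
  split.
    by apply: le_trans h11; rewrite lee_fin opprD addrA lerD2r.
  by apply: (le_trans h12); rewrite lee_fin addrA lerD2r.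
have Tv := sup_dist_fin_num (H 1 ltr01).
rewrite Tv; congr (_ \o _); apply: sup_dist_eqP => e e0; rewrite -Tv.
by rewrite (splitr e) H// divr_gt0.
Qed.

(** The lower bound holds for every member of the infimum and so passes to it; the upper bound comes
    from the single member [s = t]. *)
Lemma new_lax_oleinik_dist t u v (d : R) : 0 <= t ->
  (forall s, t <= s -> (sup_dist (lax_oleinik L s u) v <= d%:E)%E) ->
  (sup_dist (new_lax_oleinik L t u) v <= d%:E)%E.
Proof.
move=> t0 H; apply/sup_dist_leP => x; split.
  apply/ereal_infP => _ [s /= + <-]; rewrite in_itv /= => /andP[/H/sup_dist_leP h _].
  by have [] := h x.
apply: ge_ereal_inf; exists (lax_oleinik L t u x).
  by exists t => //=; rewrite in_itv /= lexx mulr2n lerDl.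
by have /sup_dist_leP/(_ x)[] := H _ (lexx t).
Qed.

Lemma lax_oleinik_dist_fixed t u v (d : R) : 0 <= t ->
  fixed_point (lax_oleinik L) v ->
  (sup_dist (lax_oleinik L t u) v <= d%:E)%E ->
  forall s, t <= s -> (sup_dist (lax_oleinik L s u) v <= d%:E)%E.
Proof.
move=> t0 fv uv s ts; have Tu := sup_dist_fin_num uv.
have st0 : 0 <= s - t by rewrite subr_ge0.
rewrite -(subrKC t s) (lax_oleinik_semigroup st0 t0 Tu).
apply: (lax_oleinik_dist (fv _ st0)).
(* The two arguments of [sup_dist] have different types, so they are exchanged through the pointwise
   bounds. *)
move: uv; rewrite Tu => /sup_dist_leP uv; apply/sup_dist_leP => x.
have := uv x; rewrite /= !lee_fin => -[h1 h2].
by rewrite lerBlDr h2 -lerBlDr h1.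
Qed.
End LaxOleinik.

(** * Convergence, distance estimate and fixed points of the new operators *)

Theorem proposition4p4 (R : realType) (n : nat) (M : ptopologicalType)
    (A : smooth_atlas R n M) (g : riemannian_metric A) (L : tangent A -> R)
    (M_hausdorff : hausdorff_space M)
    (M_compact : compact [set: M])
    (M_connected : connected [set: M])
    (L_C2 : C2_lagrangian L)
    (L_posdef : positive_definite L)
    (L_superlinear : superlinear g L)
    (L_critical : mane_critical_value L 0)
    (ubar : (M -> R) -> (M -> R))
    (ubar_continuous : forall u : M -> R, continuous u -> continuous (ubar u))
    (ubar_limit : forall u : M -> R, continuous u ->
       uniform_limit (fun t => lax_oleinik L t u) (ubar u)) :
  [/\ forall u : M -> R, continuous u ->
        uniform_limit (fun t => new_lax_oleinik L t u) (ubar u),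
      forall (t : R) (u : M -> R), 0 <= t -> continuous u ->
        (sup_dist (new_lax_oleinik L t u) (ubar u)
           <= sup_dist (lax_oleinik L t u) (ubar u))%E
    & forall u : M -> R, continuous u ->
        fixed_point (new_lax_oleinik L) u <-> fixed_point (lax_oleinik L) u].
Proof.
have L_continuous := C2_lagrangian_continuous L_C2.
have ubar_fixed u : continuous u -> fixed_point (lax_oleinik L) (ubar u).
  by move=> /ubar_limit; exact: uniform_limit_fixed_point.
have new_limit u : continuous u ->
    uniform_limit (fun t => new_lax_oleinik L t u) (ubar u).
  move=> /ubar_limit uu; apply/uniform_limitP => e e0.
  have [t0 t0_gt0 H] := uniform_limit_ex e0 uu.
  exists t0; split; first exact: num_real.
  move=> t tt; apply: new_lax_oleinik_dist => [|s ts].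
    exact: ltW (lt_trans t0_gt0 tt).
  by apply: H; exact: le_trans (ltW tt) ts.
split=> //.
- move=> t u t0 uc; set d := sup_dist (lax_oleinik L t u) (ubar u).
  have : (0 <= d)%E by exact: sup_dist_ge0.
  (* An infinite distance makes the claim trivial; a finite one persists at all times after [t]
     because [ubar u] is fixed. *)
  case dE : d => [r| |]//; last by move=> _; exact: leey.
  move=> _; apply: new_lax_oleinik_dist => // s ts.
  apply: (lax_oleinik_dist_fixed L_continuous t0) ts; first exact: ubar_fixed.
  by rewrite -dE lexx.
- move=> u uc; split=> [Nu|Tu] t t0.
    suff uE : u = ubar u by rewrite {1 2}uE; exact: ubar_fixed.
    apply: sup_dist_eqP => e e0.
    (* At a large time [t1] the new operator returns [u], so [u] is within every [e] of its
       limit. *)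
    have [t1 t1_gt0 /(_ _ (lexx _))] := uniform_limit_ex e0 (new_limit u uc).
    by rewrite Nu// ltW.
  apply/funext => x; rewrite /new_lax_oleinik.
  (* Every member of the infimum equals [u x], and [s = t] shows that there is one. *)
  rewrite (_ : [set _ | _ in _] = [set (u x)%:E]) ?ereal_inf1//.
  apply/seteqP; split=> [_ [s /= + <-]|_ ->].
    by rewrite in_itv /= => /andP[ts _]; rewrite Tu// (le_trans t0).
  by exists t; rewrite /= ?Tu// in_itv /= lexx mulr2n lerDl.
Qed.
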